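(* Let $p\in\mathbb{R}$. The inequality $$TQ(a,b)<\mathcal{I}_p(a,b)$$ holds for all $a,b>0$ with $a\ne b$ if and only if $p\ge 3/4$.
   Context: For $a,b>0$, the Toader-Qi mean is $$TQ(a,b)=\frac2\pi\int_0^{\pi/2}a^{\cos^2\theta}b^{\sin^2\theta}\,d\theta.$$ The identric (exponential) mean of $a,b>0$ with $a\neq b$ is $\mathcal{I}(a,b)=e^{-1}\left(\frac{b^b}{a^a}\right)^{1/(b-a)}$. The $p$-order identric mean is $\mathcal{I}_p(a,b)=\mathcal{I}(a^p,b^p)^{1/p}$ if $p\ne0$, and $\mathcal{I}_0(a,b)=\sqrt{ab}$. *)

(* Defs.v *)
(* Stdlib reals with Coquelicot. *)
From Stdlib Require Import Reals Lra.
From Coquelicot Require Import Coquelicot.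
Open Scope R_scope.

(* [Rpower x y] is the real power only for [0 < x], and [identric a b] is
   meaningful only for [a <> b]. *)

Definition TQ (a b : R) : R :=
  2 / PI *
  RInt (fun theta => Rpower a (cos theta ^ 2) * Rpower b (sin theta ^ 2))
    0 (PI / 2).

Definition identric (a b : R) : R :=
  / exp 1 * Rpower (Rpower b b / Rpower a a) (1 / (b - a)).

Definition identric_order (p a b : R) : R :=
  if Req_EM_T p 0 then sqrt (a * b)
  else Rpower (identric (Rpower a p) (Rpower b p)) (1 / p).

(* Main.v *)
Require Import Defs.
From Stdlib Require Import Reals Lra.
From Coquelicot Require Import Coquelicot.
Open Scope R_scope.

(** Write [a = exp (m + t)] and [b = exp (m - t)]. The integrand of [TQ a b] is
    then [exp (m + t * cos (2 * theta))], and averaging over the reflection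
    [theta -> PI / 2 - theta] gives [TQ a b = exp m * bessel_I0 t], with
    [bessel_I0] the modified Bessel function of order zero. In the same
    coordinates the identric mean of order [p] is
    [exp m * exp (t * langevin (p * t))], where
    [langevin y = coth y - 1 / y]. The claim becomes
    [bessel_I0 t < exp (t * langevin (p * t))] for all [t <> 0] exactly when
    [3 / 4 <= p] ([TQ_lt_identric_order_iff]).

    Sufficiency. Since [langevin] increases on the positive reals, [p = 3 / 4]
    is the hardest case. There the power mean of order [1 / 2], which after
    division by [exp m] is [(1 + cosh t) / 2 = cosh (t / 2) ^ 2], separates the
    two sides. It bounds
    [bessel_I0 t] because [cosh (s * t) <= 1 + s ^ 2 * (cosh t - 1)] for
    [|s| <= 1] and the average of [cos (2 * theta) ^ 2] is [1 / 2]
    ([bessel_I0_le]). It lies strictly below the identric mean by Stolarsky's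
    inequality ([power_mean_lt_identric]), which follows by differentiating
    its logarithmic form: the derivative is positive by the hyperbolic Huygens
    inequality [3 * x < 2 * sinh x + tanh x].

    Necessity. For small [t] the logarithms of the two sides behave like
    [t ^ 2 / 4] and [p * t ^ 2 / 3]. When [0 < p < 3 / 4] the bounds
    [1 + t ^ 2 / 4 <= bessel_I0 t] and [langevin y <= y / 3] make this
    quantitative and contradict the inequality at
    [t = 2 * sqrt (1 - 4 * p / 3)]. When [p <= 0] the identric mean is at most
    the geometric mean, which [TQ] never falls below. *)

(** * Monotonicity *)

Lemma exp_le (x y : R) : x <= y -> exp x <= exp y.
Proof. intros [H| ->]; [apply Rlt_le, exp_increasing, H | apply Rle_refl]. Qed.

Lemma increasing_of_derive_pos (f f' : R -> R) (a b : R) :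
  a < b ->
  (forall x, a <= x <= b -> is_derive f x (f' x)) ->
  (forall x, a < x < b -> 0 < f' x) ->
  f a < f b.
Proof.
  intros Hab Hd Hpos.
  destruct (MVT_cor2 f f' a b Hab) as [c [Hc Hin]].
  - intros x Hx. apply is_derive_Reals. now apply Hd.
  - specialize (Hpos c Hin).
    assert (0 < f' c * (b - a)) by (apply Rmult_lt_0_compat; lra). lra.
Qed.

Lemma nondecreasing_of_derive_nonneg (f f' : R -> R) (a b : R) :
  a <= b ->
  (forall x, a <= x <= b -> is_derive f x (f' x)) ->
  (forall x, a < x < b -> 0 <= f' x) ->
  f a <= f b.
Proof.
  intros Hab Hd Hpos.
  destruct (Req_dec a b) as [->|Hne]; [lra|].
  destruct (MVT_cor2 f f' a b) as [c [Hc Hin]]; [lra| |].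
  - intros x Hx. apply is_derive_Reals. now apply Hd.
  - specialize (Hpos c Hin).
    assert (0 <= f' c * (b - a)) by (apply Rmult_le_pos; lra). lra.
Qed.

(** * Hyperbolic inequalities *)

Lemma is_derive_cosh (x : R) : is_derive cosh x (sinh x).
Proof. apply is_derive_Reals, derivable_pt_lim_cosh. Qed.

Lemma cosh_sinh_sqr (x : R) : (cosh x)^2 - (sinh x)^2 = 1.
Proof.
  unfold cosh, sinh. rewrite exp_Ropp.
  field. apply Rgt_not_eq, exp_pos.
Qed.

Lemma sinh_neg (x : R) : sinh (- x) = - sinh x.
Proof. unfold sinh. rewrite Ropp_involutive. field. Qed.

Lemma cosh_neg (x : R) : cosh (- x) = cosh x.
Proof. unfold cosh. rewrite Ropp_involutive. field. Qed.

Lemma cosh_half_angle (x : R) : cosh x = 1 + 2 * (sinh (x / 2))^2.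
Proof.
  unfold cosh, sinh. replace x with (x / 2 + x / 2) at 1 2 by field.
  rewrite Ropp_plus_distr, !exp_plus, exp_Ropp.
  field. apply Rgt_not_eq, exp_pos.
Qed.

Lemma cosh_minus (x y : R) :
  cosh (x - y) = cosh x * cosh y - sinh x * sinh y.
Proof.
  unfold cosh, sinh, Rminus.
  rewrite Ropp_plus_distr, Ropp_involutive, !exp_plus. field.
Qed.

Lemma sinh_cosh_product (x y : R) :
  2 * (sinh x * cosh y) = sinh (x + y) + sinh (x - y).
Proof.
  unfold cosh, sinh, Rminus.
  rewrite !Ropp_plus_distr, Ropp_involutive, !exp_plus. field.
Qed.

Lemma cosh_gt_1 (x : R) : x <> 0 -> 1 < cosh x.
Proof.
  intros H. unfold cosh.
  assert (H1 := exp_ineq1 x H).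
  assert (H2 := exp_ineq1 (- x) ltac:(lra)). lra.
Qed.

Lemma cosh_ge_1 (x : R) : 1 <= cosh x.
Proof.
  destruct (Req_dec x 0) as [->|H]; [rewrite cosh_0; lra|].
  apply Rlt_le, cosh_gt_1, H.
Qed.

Lemma lt_sinh (x : R) : 0 < x -> x < sinh x.
Proof.
  intros Hx.
  assert (H := increasing_of_derive_pos (fun y => sinh y - y)
                 (fun y => cosh y - 1) 0 x Hx).
  cbv beta in H. rewrite sinh_0 in H.
  enough (0 - 0 < sinh x - x) by lra. apply H.
  - intros y _. auto_derive.
    + exact I.
    + ring.
  - intros y Hy. assert (1 < cosh y) by (apply cosh_gt_1; lra). lra.
Qed.

Lemma sinh_nonneg (x : R) : 0 <= x -> 0 <= sinh x.
Proof.
  intros [Hx| <-]; [assert (H := lt_sinh x Hx); lra | rewrite sinh_0; lra].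
Qed.

(** The half-angle formula turns this into [x / 2 <= sinh (x / 2)]. *)
Lemma cosh_ge_quadratic (x : R) : 1 + x^2 / 2 <= cosh x.
Proof.
  assert (P : forall y, 0 <= y -> 1 + y^2 / 2 <= cosh y).
  { intros y Hy. rewrite cosh_half_angle.
    assert (H : y / 2 <= sinh (y / 2)).
    { destruct (Req_dec y 0) as [->|Hne].
      - replace (0 / 2) with 0 by field. rewrite sinh_0. lra.
      - apply Rlt_le, lt_sinh. lra. }
    nra. }
  destruct (Rle_dec 0 x) as [Hx|Hx]; [now apply P|].
  rewrite <- cosh_neg. replace (x^2) with ((- x)^2) by ring.
  apply P. lra.
Qed.

Lemma cosh_le (x y : R) : 0 <= x <= y -> cosh x <= cosh y.
Proof.
  intros Hxy. apply nondecreasing_of_derive_nonneg with (f' := sinh).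
  - lra.
  - intros z _. apply is_derive_cosh.
  - intros z Hz. apply sinh_nonneg. lra.
Qed.

Lemma sinh_le_x_cosh (x : R) : 0 <= x -> sinh x <= x * cosh x.
Proof.
  intros Hx.
  assert (H := nondecreasing_of_derive_nonneg (fun y => y * cosh y - sinh y)
                 (fun y => y * sinh y) 0 x Hx).
  cbv beta in H. rewrite sinh_0, cosh_0 in H.
  enough (0 * 1 - 0 <= x * cosh x - sinh x) by lra. apply H.
  - intros y _. auto_derive.
    + exact I.
    + ring.
  - intros y Hy. apply Rmult_le_pos; [lra|]. apply sinh_nonneg. lra.
Qed.

(** Convexity of [sinh] on the nonnegative reals, in chord form from the
    origin. *)
Lemma sinh_scaled_le (s x : R) : 0 <= s <= 1 -> 0 <= x ->
  sinh (s * x) <= s * sinh x.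
Proof.
  intros Hs Hx.
  assert (H := nondecreasing_of_derive_nonneg
                 (fun y => s * sinh y - sinh (s * y))
                 (fun y => s * cosh y - s * cosh (s * y)) 0 x Hx).
  cbv beta in H. rewrite Rmult_0_r, sinh_0 in H.
  enough (s * 0 - 0 <= s * sinh x - sinh (s * x)) by lra. apply H.
  - intros y _. auto_derive.
    + exact I.
    + ring.
  - intros y Hy.
    assert (cosh (s * y) <= cosh y) by (apply cosh_le; nra). nra.
Qed.

(** The Taylor terms of [cosh (s * x) - 1] carry [s ^ (2 * n)], which is at most
    [s ^ 2]. The half-angle formula replaces the series by the squared
    inequality [sinh (s * x / 2) <= s * sinh (x / 2)]. *)
Lemma cosh_scaled_le (s x : R) : -1 <= s <= 1 ->
  cosh (s * x) <= 1 + s^2 * (cosh x - 1).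
Proof.
  assert (P : forall s x, 0 <= s <= 1 -> 0 <= x ->
            cosh (s * x) <= 1 + s^2 * (cosh x - 1)).
  { intros s' x' Hs Hx. rewrite !cosh_half_angle.
    replace (s' * x' / 2) with (s' * (x' / 2)) by field.
    assert (H := sinh_scaled_le s' (x' / 2) Hs ltac:(lra)).
    assert (H0 : 0 <= sinh (s' * (x' / 2))) by (apply sinh_nonneg; nra).
    assert (H1 := pow_incr _ _ 2 (conj H0 H)). lra. }
  assert (Q : forall s x, 0 <= s <= 1 ->
            cosh (s * x) <= 1 + s^2 * (cosh x - 1)).
  { intros s' x' Hs. destruct (Rle_dec 0 x') as [Hx|Hx]; [now apply P|].
    rewrite <- cosh_neg, <- (cosh_neg x').
    replace (- (s' * x')) with (s' * - x') by ring. apply P; lra. }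
  intros Hs. destruct (Rle_dec 0 s) as [H|H]; [apply Q; lra|].
  replace (s * x) with (- (- s * x)) by ring. rewrite cosh_neg.
  replace (s^2) with ((- s)^2) by ring. apply Q. lra.
Qed.

(** The derivative of the difference is [c + c + 1 / c ^ 2 - 3] with
    [c = cosh x]. It is positive by the inequality between the arithmetic and
    geometric means of [c], [c] and [1 / c ^ 2], strict since [1 < c]. *)
Lemma hyperbolic_huygens (x : R) : 0 < x ->
  3 * x < 2 * sinh x + sinh x / cosh x.
Proof.
  intros Hx.
  assert (H := increasing_of_derive_pos
                 (fun y => 2 * sinh y + sinh y / cosh y - 3 * y)
                 (fun y => 2 * cosh y + / (cosh y)^2 - 3) 0 x Hx).
  cbv beta in H. rewrite sinh_0, cosh_0 in H.
  enough (2 * 0 + 0 / 1 - 3 * 0 < 2 * sinh x + sinh x / cosh x - 3 * x) by lra.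
  apply H.
  - intros y _. assert (Hc := cosh_ge_1 y). auto_derive.
    + repeat split; lra.
    + replace (/ cosh y ^ 2) with ((cosh y ^ 2 - sinh y ^ 2) / cosh y ^ 2)
        by (rewrite cosh_sinh_sqr; field; lra).
      field. lra.
  - intros y Hy. assert (Hc : 1 < cosh y) by (apply cosh_gt_1; lra).
    replace (2 * cosh y + / cosh y ^ 2 - 3)
      with ((cosh y - 1)^2 * (2 * cosh y + 1) / cosh y ^ 2) by (field; lra).
    apply Rdiv_lt_0_compat; [|nra].
    apply Rmult_lt_0_compat; nra.
Qed.

(** * The function coth y - 1 / y *)

Definition langevin (y : R) : R := cosh y / sinh y - 1 / y.

Lemma is_derive_langevin (y : R) : 0 < y ->
  is_derive langevin y (1 / y^2 - 1 / (sinh y)^2).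
Proof.
  intros Hy. assert (Hs := lt_sinh y Hy). unfold langevin. auto_derive.
  - repeat split; try lra.
  - replace (1 / sinh y ^ 2) with ((cosh y ^ 2 - sinh y ^ 2) / sinh y ^ 2)
        by (rewrite cosh_sinh_sqr; field; lra).
    field. lra.
Qed.

Lemma langevin_neg (y : R) : y <> 0 -> langevin (- y) = - langevin y.
Proof.
  intros Hy. unfold langevin. rewrite cosh_neg, sinh_neg.
  assert (sinh y <> 0).
  { destruct (Rlt_dec 0 y).
    - assert (H := lt_sinh y r). lra.
    - assert (H := lt_sinh (- y) ltac:(lra)). rewrite sinh_neg in H. lra. }
  field. auto.
Qed.

Lemma langevin_le (x y : R) : 0 < x <= y -> langevin x <= langevin y.
Proof.
  intros Hxy.
  apply nondecreasing_of_derive_nonneg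
    with (f' := fun z => 1 / z^2 - 1 / (sinh z)^2).
  - lra.
  - intros z Hz. apply is_derive_langevin. lra.
  - intros z Hz. assert (Hs := lt_sinh z ltac:(lra)).
    enough (1 / (sinh z)^2 <= 1 / z^2) by lra.
    unfold Rdiv. apply Rmult_le_compat_l; [lra|].
    apply Rinv_le_contravar; nra.
Qed.

Lemma langevin_nonneg (y : R) : 0 < y -> 0 <= langevin y.
Proof.
  intros Hy. assert (Hs := lt_sinh y Hy).
  assert (Hc := sinh_le_x_cosh y ltac:(lra)). unfold langevin.
  replace (cosh y / sinh y - 1 / y)
    with ((y * cosh y - sinh y) / (y * sinh y)) by (field; lra).
  apply Rle_mult_inv_pos; [lra|]. nra.
Qed.

(** The constant [1 / 3] is the derivative of [langevin] at the origin; it is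
    what makes [3 / 4] the critical order. *)
Lemma langevin_le_third (y : R) : 0 < y -> langevin y <= y / 3.
Proof.
  intros Hy. assert (Hs := lt_sinh y Hy). unfold langevin.
  assert (H := nondecreasing_of_derive_nonneg
                 (fun z => sinh z * (1 + z^2 / 3) - z * cosh z)
                 (fun z => z / 3 * (z * cosh z - sinh z)) 0 y ltac:(lra)).
  cbv beta in H. rewrite sinh_0, cosh_0 in H.
  assert (K : 0 <= sinh y * (1 + y^2 / 3) - y * cosh y).
  { replace 0 with (0 * (1 + 0 ^ 2 / 3) - 0 * 1) by field. apply H.
    - intros z _. auto_derive.
      + exact I.
      + field.
    - intros z Hz. assert (Hc := sinh_le_x_cosh z ltac:(lra)).
      apply Rmult_le_pos; lra. }
  enough (0 <= y / 3 - (cosh y / sinh y - 1 / y)) by lra.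
  replace (y / 3 - (cosh y / sinh y - 1 / y))
    with ((sinh y * (1 + y^2 / 3) - y * cosh y) / (y * sinh y))
    by (field; lra).
  apply Rle_mult_inv_pos; [lra|]. nra.
Qed.

(** * The power mean of order one half lies below the identric mean *)

(** Half the logarithm of the ratio of the identric mean of order [3 / 4] to
    the power mean of order [1 / 2], at [a = exp (2 * x)] and
    [b = exp (- 2 * x)]. *)
Definition stolarsky_gap (x : R) : R :=
  x * langevin (3 / 2 * x) - ln (cosh x).

(** The derivative of [x * coth (3 * x / 2) - 2 / 3 - ln (cosh x)] is
    [cosh (x / 2) / (sinh (3 * x / 2) * cosh x) - (3 * x / 2) /
    sinh (3 * x / 2) ^ 2]. Multiplying out and using
    [2 * sinh (3 * x / 2) * cosh (x / 2) = sinh (2 * x) + sinh x], its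
    positivity is the hyperbolic Huygens inequality. *)
Lemma stolarsky_gap_increasing (x y : R) : 0 < x < y ->
  stolarsky_gap x < stolarsky_gap y.
Proof.
  intros Hxy.
  apply increasing_of_derive_pos
    with (f' := fun z => langevin (3 / 2 * z)
      + z * (3 / 2 * (1 / (3 / 2 * z)^2 - 1 / (sinh (3 / 2 * z))^2))
      - sinh z / cosh z).
  - lra.
  - intros z Hz. unfold stolarsky_gap.
    assert (Hl := is_derive_langevin (3 / 2 * z) ltac:(lra)).
    assert (Hc := cosh_ge_1 z). auto_derive.
    + repeat split; try lra.
      * eexists. exact Hl.
    + rewrite (is_derive_unique (fun y : R => langevin y) _ _ Hl). field.
      assert (H := lt_sinh (3 / 2 * z) ltac:(lra)). repeat split; lra.
  - intros z Hz. unfold langevin.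
    assert (Hh := hyperbolic_huygens z ltac:(lra)).
    assert (Hc := cosh_ge_1 z).
    assert (Hs := lt_sinh (3 / 2 * z) ltac:(lra)).
    assert (E1 : cosh (3 / 2 * z) * cosh z - sinh (3 / 2 * z) * sinh z
                 = cosh (z / 2)).
    { rewrite <- cosh_minus. f_equal. field. }
    assert (E2 : 2 * (sinh (3 / 2 * z) * cosh (z / 2))
                 = cosh z * (2 * sinh z + sinh z / cosh z)).
    { rewrite sinh_cosh_product.
      replace (3 / 2 * z + z / 2) with (z + z) by field.
      replace (3 / 2 * z - z / 2) with (z - 0) by field.
      assert (D := sinh_cosh_product z z).
      replace (z - z) with 0 in D by ring. rewrite sinh_0 in D.
      rewrite Rminus_0_r. replace (sinh (z + z)) with
        (2 * (sinh z * cosh z)) by lra. field. lra. }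
    replace (cosh (3 / 2 * z) / sinh (3 / 2 * z) - 1 / (3 / 2 * z) +
      z * (3 / 2 * (1 / (3 / 2 * z) ^ 2 - 1 / sinh (3 / 2 * z) ^ 2)) -
      sinh z / cosh z)
      with ((sinh (3 / 2 * z) * (cosh (3 / 2 * z) * cosh z
              - sinh (3 / 2 * z) * sinh z) - 3 / 2 * z * cosh z)
            / (sinh (3 / 2 * z) ^ 2 * cosh z)) by (field; lra).
    rewrite E1. apply Rdiv_lt_0_compat; nra.
Qed.

(** The gap tends to zero at the origin and increases. Instead of that limit
    the proof uses the lower bound [- e] for the gap at a small [e], which comes
    from [0 <= langevin] and [cosh e <= exp e]. *)
Lemma stolarsky_gap_pos (x : R) : 0 < x -> 0 < stolarsky_gap x.
Proof.
  intros Hx.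
  apply Rle_lt_trans with (stolarsky_gap (x / 2));
    [|apply stolarsky_gap_increasing; lra].
  apply Rnot_lt_le. intros Hneg.
  (* A point below [x / 2] where [- e] is at least the supposed negative value
     of the gap at [x / 2]. *)
  set (e := Rmin (x / 4) (- stolarsky_gap (x / 2))).
  assert (He : 0 < e) by (apply Rmin_glb_lt; lra).
  assert (He1 : e <= x / 4) by apply Rmin_l.
  assert (He2 : e <= - stolarsky_gap (x / 2)) by apply Rmin_r.
  assert (Hinc := stolarsky_gap_increasing e (x / 2) ltac:(lra)).
  unfold stolarsky_gap at 1 in Hinc.
  assert (Hl := langevin_nonneg (3 / 2 * e) ltac:(lra)).
  assert (Hln : ln (cosh e) <= e).
  { rewrite <- (ln_exp e) at 2. apply ln_le.
    - assert (H := cosh_ge_1 e). lra.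
    - unfold cosh. assert (exp (- e) < exp e) by (apply exp_increasing; lra).
      lra. }
  assert (0 <= e * langevin (3 / 2 * e)) by (apply Rmult_le_pos; lra).
  lra.
Qed.

Lemma power_mean_lt_identric (t : R) : 0 < t ->
  (1 + cosh t) / 2 < exp (t * langevin (3 / 4 * t)).
Proof.
  intros Ht. assert (H := stolarsky_gap_pos (t / 2) ltac:(lra)).
  unfold stolarsky_gap in H.
  replace (3 / 2 * (t / 2)) with (3 / 4 * t) in H by field.
  assert (Hc := cosh_ge_1 (t / 2)).
  replace ((1 + cosh t) / 2) with (exp (2 * ln (cosh (t / 2)))).
  - apply exp_increasing. lra.
  - replace (2 * ln (cosh (t / 2))) with (ln (cosh (t / 2)) + ln (cosh (t / 2)))
      by ring.
    rewrite exp_plus, exp_ln by lra. rewrite (cosh_half_angle t).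
    assert (H1 := cosh_sinh_sqr (t / 2)). nra.
Qed.

(** * Bounds on the Bessel integral *)

Definition bessel_I0 (t : R) : R :=
  2 / PI * RInt (fun theta => cosh (t * cos (2 * theta))) 0 (PI / 2).

Lemma ex_RInt_of_derivable (f : R -> R) (a b : R) :
  (forall x, ex_derive f x) -> ex_RInt f a b.
Proof.
  intros H. apply (ex_RInt_continuous (V := R_CompleteNormedModule)).
  intros x _. apply (ex_derive_continuous (V := R_NormedModule)), H.
Qed.

Lemma is_RInt_quadratic (A B : R) :
  is_RInt (fun theta => A + cos (2 * theta) ^ 2 * B) 0 (PI / 2)
    (PI / 2 * (A + B / 2)).
Proof.
  (* An antiderivative of [cos y ^ 2] is [(y + sin y * cos y) / 2]; here
     [y = 2 * theta]. *)
  set (F := fun theta =>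
     A * theta + B * (theta / 2 + sin (2 * theta) * cos (2 * theta) / 4)).
  replace (PI / 2 * (A + B / 2)) with (minus (F (PI / 2)) (F 0)).
  - apply (is_RInt_derive F).
    + intros x _. unfold F. auto_derive; [exact I|].
      assert (H := sin2_cos2 (2 * x)). unfold Rsqr in H.
      transitivity (A + B * (1 / 2 + (cos (2 * x) * cos (2 * x)
                                      - sin (2 * x) * sin (2 * x)) / 2)).
      * field.
      * replace (sin (2 * x) * sin (2 * x)) with (1 - cos (2 * x) * cos (2 * x))
          by lra. field.
    + intros x _. apply (ex_derive_continuous (V := R_NormedModule)).
      auto_derive. exact I.
  - unfold F, minus, plus, opp; simpl.
    replace (2 * (PI / 2)) with PI by field.
    rewrite (Rmult_0_r 2), sin_PI, sin_0. field.
Qed.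

Lemma bessel_I0_ge (t : R) : 1 + t^2 / 4 <= bessel_I0 t.
Proof.
  assert (HPI := PI_RGT_0). unfold bessel_I0.
  replace (1 + t^2 / 4) with (2 / PI * (PI / 2 * (1 + t^2 / 2 / 2)))
    by (field; lra).
  apply Rmult_le_compat_l; [apply Rlt_le, Rdiv_lt_0_compat; lra|].
  rewrite <- (is_RInt_unique _ _ _ _ (is_RInt_quadratic 1 (t^2 / 2))).
  apply RInt_le; [lra | eexists; apply is_RInt_quadratic | |].
  - apply ex_RInt_of_derivable. intros x. auto_derive. exact I.
  - intros x _. assert (H := cosh_ge_quadratic (t * cos (2 * x))). lra.
Qed.

Lemma bessel_I0_le (t : R) : bessel_I0 t <= (1 + cosh t) / 2.
Proof.
  assert (HPI := PI_RGT_0). unfold bessel_I0.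
  replace ((1 + cosh t) / 2) with (2 / PI * (PI / 2 * (1 + (cosh t - 1) / 2)))
    by (field; lra).
  apply Rmult_le_compat_l; [apply Rlt_le, Rdiv_lt_0_compat; lra|].
  rewrite <- (is_RInt_unique _ _ _ _ (is_RInt_quadratic 1 (cosh t - 1))).
  apply RInt_le; [lra | | eexists; apply is_RInt_quadratic |].
  - apply ex_RInt_of_derivable. intros x. auto_derive. exact I.
  - intros x _. rewrite Rmult_comm. apply cosh_scaled_le.
    apply COS_bound.
Qed.

(** * Both means in exponential coordinates *)

(** The substitution [theta -> PI / 2 - theta] changes the sign of
    [cos (2 * theta)]. *)
Lemma RInt_exp_cos_reflect (t : R) :
  RInt (fun theta => exp (t * cos (2 * theta))) 0 (PI / 2) =
  RInt (fun theta => exp (- (t * cos (2 * theta)))) 0 (PI / 2).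
Proof.
  set (f := fun theta => exp (t * cos (2 * theta))).
  assert (H := RInt_comp_lin f (-1) (PI / 2) 0 (PI / 2)).
  replace (-1 * 0 + PI / 2) with (PI / 2) in H by ring.
  replace (-1 * (PI / 2) + PI / 2) with 0 in H by ring.
  rewrite <- (opp_RInt_swap f) by
    (apply ex_RInt_of_derivable; intros x; unfold f; auto_derive; exact I).
  rewrite <- H by
    (apply ex_RInt_of_derivable; intros x; unfold f; auto_derive; exact I).
  rewrite <- RInt_opp.
  - apply RInt_ext. intros x _. unfold f, opp, scal, mult; simpl.
    unfold mult; simpl.
    replace (2 * (-1 * x + PI / 2)) with (- (2 * x) + PI) by field.
    rewrite neg_cos, cos_neg.
    replace (t * - cos (2 * x)) with (- (t * cos (2 * x))) by ring. ring.
  - apply ex_RInt_of_derivable; intros x; unfold f, scal; simpl.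
    unfold mult; simpl. auto_derive; exact I.
Qed.

Lemma RInt_exp_cos (t : R) :
  RInt (fun theta => exp (t * cos (2 * theta))) 0 (PI / 2) =
  RInt (fun theta => cosh (t * cos (2 * theta))) 0 (PI / 2).
Proof.
  assert (E1 : ex_RInt (fun theta => exp (t * cos (2 * theta))) 0 (PI / 2))
    by (apply ex_RInt_of_derivable; intros x; auto_derive; exact I).
  assert (E2 : ex_RInt (fun theta => exp (- (t * cos (2 * theta)))) 0 (PI / 2))
    by (apply ex_RInt_of_derivable; intros x; auto_derive; exact I).
  assert (H := RInt_exp_cos_reflect t).
  assert (P := RInt_plus _ _ _ _ E1 E2). unfold plus in P; simpl in P.
  rewrite <- H in P.
  assert (S := RInt_scal _ _ _ (/ 2) (ex_RInt_plus _ _ _ _ E1 E2)).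
  unfold plus, scal, mult in S; simpl in S. unfold mult in S; simpl in S.
  rewrite P in S. symmetry.
  rewrite (RInt_ext _ (fun theta => / 2 * (exp (t * cos (2 * theta))
     + exp (- (t * cos (2 * theta))))))
    by (intros x _; unfold cosh, Rdiv; apply Rmult_comm).
  rewrite S.
  assert (E : forall X : R, / 2 * (X + X) = X) by (intros X; field). apply E.
Qed.

(** The exponent [cos theta ^ 2 * (m + t) + sin theta ^ 2 * (m - t)] is
    [m + t * cos (2 * theta)]. *)
Lemma TQ_bessel (m t : R) :
  TQ (exp (m + t)) (exp (m - t)) = exp m * bessel_I0 t.
Proof.
  unfold TQ, bessel_I0. rewrite <- RInt_exp_cos.
  assert (E : ex_RInt (fun theta => exp (t * cos (2 * theta))) 0 (PI / 2))
    by (apply ex_RInt_of_derivable; intros x; auto_derive; exact I).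
  assert (S := RInt_scal _ _ _ (exp m) E).
  unfold scal, mult in S; simpl in S. unfold mult in S; simpl in S.
  rewrite (Rmult_comm (exp m)), Rmult_assoc, (Rmult_comm _ (exp m)).
  f_equal. etransitivity; [|exact S].
  apply RInt_ext. intros x _. unfold Rpower.
  rewrite !ln_exp, <- !exp_plus. f_equal.
  rewrite cos_2a.
  assert (H := sin2_cos2 x). unfold Rsqr in H.
  replace (sin x ^ 2) with (1 - cos x ^ 2) by lra.
  replace (sin x * sin x) with (1 - cos x * cos x) by lra. ring.
Qed.

Lemma identric_exp (x y : R) :
  identric (exp x) (exp y) =
  exp ((exp y * y - exp x * x) * (1 / (exp y - exp x)) - 1).
Proof.
  unfold identric, Rpower. rewrite !ln_exp.
  replace (exp (exp y * y) / exp (exp x * x))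
    with (exp (exp y * y - exp x * x))
    by (unfold Rminus; rewrite exp_plus, exp_Ropp; reflexivity).
  rewrite ln_exp.
  rewrite <- exp_Ropp, <- exp_plus. f_equal. ring.
Qed.

Lemma identric_order_langevin (p m t : R) : p <> 0 -> t <> 0 ->
  identric_order p (exp (m + t)) (exp (m - t))
  = exp m * exp (t * langevin (p * t)).
Proof.
  intros Hp Ht. unfold identric_order.
  destruct (Req_EM_T p 0) as [E|_]; [contradiction|].
  unfold Rpower. rewrite !ln_exp, identric_exp, ln_exp, <- exp_plus.
  f_equal.
  replace (p * (m + t)) with (p * m + p * t) by ring.
  replace (p * (m - t)) with (p * m + - (p * t)) by ring.
  rewrite !exp_plus. unfold langevin, cosh, sinh.
  assert (Hpt : p * t <> 0) by (apply Rmult_integral_contrapositive; auto).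
  assert (Hd : exp (p * t) - exp (- (p * t)) <> 0).
  { intros H. assert (H' : exp (p * t) = exp (- (p * t))) by lra.
    apply exp_inv in H'. lra. }
  assert (Hm := exp_pos (p * m)).
  field. repeat split; auto; try lra.
  replace (exp (p * m) * exp (- (p * t)) - exp (p * m) * exp (p * t))
    with (- (exp (p * m) * (exp (p * t) - exp (- (p * t))))) by ring.
  apply Ropp_neq_0_compat, Rmult_integral_contrapositive. split; lra.
Qed.

Lemma TQ_lt_identric_order_iff (p m t : R) : p <> 0 -> t <> 0 ->
  TQ (exp (m + t)) (exp (m - t)) < identric_order p (exp (m + t)) (exp (m - t))
  <-> bessel_I0 t < exp (t * langevin (p * t)).
Proof.
  intros Hp Ht. rewrite TQ_bessel, identric_order_langevin by assumption.
  split; [|apply Rmult_lt_compat_l; apply exp_pos].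
  apply Rmult_lt_reg_l, exp_pos.
Qed.

(** * Sufficiency and necessity *)

Lemma bessel_I0_lt (p t : R) : 3 / 4 <= p -> 0 < t ->
  bessel_I0 t < exp (t * langevin (p * t)).
Proof.
  intros Hp Ht. apply Rle_lt_trans with (1 := bessel_I0_le t).
  apply Rlt_le_trans with (1 := power_mean_lt_identric t Ht).
  apply exp_le, Rmult_le_compat_l; [lra|].
  apply langevin_le. nra.
Qed.

Lemma bessel_I0_neg (t : R) : bessel_I0 (- t) = bessel_I0 t.
Proof.
  unfold bessel_I0. f_equal. apply RInt_ext. intros x _.
  rewrite Ropp_mult_distr_l_reverse. apply cosh_neg.
Qed.

(** With [u = 1 - q = t ^ 2 / 4], the bound [1 + u <= bessel_I0 t] reduces this
    to [exp (q * u) <= 1 + u]. As [exp (- (q * u)) >= 1 - q * u], it is enough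
    that [(1 + u) * (1 - q * u) >= 1], which holds as long as
    [q * u <= 1 - q]; the choice [u = 1 - q] achieves this. *)
Lemma exp_le_bessel_I0 (q : R) : 0 < q < 1 ->
  exp (q * (1 - q)) <= bessel_I0 (2 * sqrt (1 - q)).
Proof.
  intros Hq.
  apply Rle_trans with (2 := bessel_I0_ge _).
  replace ((2 * sqrt (1 - q))^2 / 4) with (1 - q)
    by (rewrite Rpow_mult_distr, pow2_sqrt by lra; field).
  assert (H := exp_ineq1_le (- (q * (1 - q)))).
  rewrite exp_Ropp in H. assert (He := exp_pos (q * (1 - q))).
  apply Rmult_le_reg_r with (/ exp (q * (1 - q)));
    [apply Rinv_0_lt_compat, He|].
  rewrite Rinv_r by lra.
  apply Rle_trans with ((1 + (1 - q)) * (1 + - (q * (1 - q)))).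
  - assert (H3 := pow_le (1 - q) 3 ltac:(lra)). lra.
  - apply Rmult_le_compat_l; lra.
Qed.

Theorem theorem8 (p : R) :
  (forall a b : R, 0 < a -> 0 < b -> a <> b -> TQ a b < identric_order p a b)
  <-> 3 / 4 <= p.
Proof.
  split.
  - intros H. apply Rnot_lt_le. intros Hp.
    assert (Hexp : forall t, 0 < t ->
      TQ (exp (0 + t)) (exp (0 - t))
      < identric_order p (exp (0 + t)) (exp (0 - t))).
    { intros t Ht. apply H; try apply exp_pos.
      intros E. apply exp_inv in E. lra. }
    destruct (Rtotal_order p 0) as [Hneg|[->|Hpos]].
    + specialize (Hexp 1 Rlt_0_1).
      rewrite TQ_lt_identric_order_iff in Hexp by lra.
      assert (Hb := bessel_I0_ge 1).
      assert (Hl := langevin_nonneg (- p) ltac:(lra)).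
      rewrite langevin_neg in Hl by lra.
      assert (He : exp (1 * langevin (p * 1)) <= 1).
      { apply Rle_trans with (exp 0); [|rewrite exp_0; lra].
        apply exp_le. rewrite Rmult_1_r. lra. }
      lra.
    + specialize (Hexp 1 Rlt_0_1). rewrite TQ_bessel in Hexp.
      unfold identric_order in Hexp.
      destruct (Req_EM_T 0 0) as [_|E]; [|now elim E].
      rewrite <- exp_plus in Hexp.
      replace (0 + 1 + (0 - 1)) with 0 in Hexp by ring.
      rewrite exp_0, sqrt_1 in Hexp.
      assert (Hb := bessel_I0_ge 1). lra.
    + set (t := 2 * sqrt (1 - 4 * p / 3)).
      assert (Ht : 0 < t)
        by (apply Rmult_lt_0_compat; [lra | apply sqrt_lt_R0; lra]).
      specialize (Hexp t Ht).
      rewrite TQ_lt_identric_order_iff in Hexp by lra.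
      assert (Hb := exp_le_bessel_I0 (4 * p / 3) ltac:(lra)).
      fold t in Hb.
      (* Here [t ^ 2 / 4 = 1 - q] with [q = 4 * p / 3], so the upper bound
         [p * t ^ 2 / 3] of the exponent is exactly [q * (1 - q)]. *)
      assert (Hl := langevin_le_third (p * t) ltac:(nra)).
      assert (He : exp (t * langevin (p * t))
                   <= exp (4 * p / 3 * (1 - 4 * p / 3))).
      { apply exp_le.
        replace (4 * p / 3 * (1 - 4 * p / 3)) with (t * (p * t / 3)).
        - apply Rmult_le_compat_l; lra.
        - assert (Hs := pow2_sqrt (1 - 4 * p / 3) ltac:(lra)).
          rewrite <- Hs at 1. unfold t. field. }
      lra.
  - intros Hp a b Ha Hb Hab.
    set (m := (ln a + ln b) / 2). set (t := (ln a - ln b) / 2).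
    assert (Ea : a = exp (m + t))
      by (rewrite <- (exp_ln a Ha) at 1; f_equal; unfold m, t; field).
    assert (Eb : b = exp (m - t))
      by (rewrite <- (exp_ln b Hb) at 1; f_equal; unfold m, t; field).
    assert (Ht : t <> 0).
    { intros E. apply Hab. rewrite Ea, Eb, E. f_equal. ring. }
    rewrite Ea, Eb. apply TQ_lt_identric_order_iff; [lra|assumption|].
    destruct (Rlt_dec 0 t) as [Hpos|Hneg]; [now apply bessel_I0_lt|].
    rewrite <- bessel_I0_neg.
    replace (t * langevin (p * t)) with (- t * langevin (p * - t)).
    + apply bessel_I0_lt; lra.
    + replace (p * - t) with (- (p * t)) by ring.
      rewrite langevin_neg; [ring|].
      apply Rmult_integral_contrapositive. split; lra.
Qed.
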